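(* Assume that $f_0$ is bounded by $M$ and satisfies $\inf_{0<x\le1}f_0(x)\ge\delta>0$. Let $\hat f_n(\cdot)$ be the density estimator on $(0,1]$ defined in the context, with thresholds $\zeta_n=O(\sqrt{\log n})$ that satisfy the uniform propagation condition $\mathrm{UP}(\alpha,\mathcal F_{j,k})$ (for a fixed $\alpha>0$) for $$\mathcal F_{j,k}=V_{j,k}\cap\Bigl\{f:\ 0<\delta\le\inf_{0<x\le1}f(x),\ \|f\|_\infty\le M\Bigr\}.$$ For $x\in(0,1]$ let $$\Delta_{j,x}(f_0)=\frac{M}{\delta^2}2^{-j}\|f_0-K_{j,x}(f_0)\|_\infty^2,\qquad j^*(x)=\min\{j\in\mathbb N:\ j\le j_{\max},\ n\Delta_{j,x}(f_0)\le\Delta\log n\},$$ with a fixed positive constant $\Delta<1/2$. Then $$\sup_{0<x\le1}\sqrt{\frac{n2^{-j^*(x)}}{\log n}}\,\bigl|\hat f_n(x)-f_0(x)\bigr|=O_{\Pr_{f_0}}(1),$$ i.e. this sequence of random variables is bounded in probability under $f_0$ as $n\to\infty$.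
   Context: $\mathbb N=\{0,1,2,\dots\}$. $\|g\|_\infty=\sup_{x\in\mathbb R}|g(x)|$. Data: $X_1,\dots,X_n$ ($n>1$) are i.i.d. with density $f_0:\mathbb R\to[0,\infty)$. $E_f,\Pr_f$ denote expectation and probability when the $X_i$ are i.i.d. with density $f$. Dyadic intervals: $I_{j,k}=(k2^{-j},(k+1)2^{-j}]$ for $j\in\mathbb N$, $k=0,\dots,2^j-1$; for $x\in(0,1]$, $I_{j,k(x)}$ is the unique such interval containing $x$. $V_{j,k}$ is the set of all bounded probability density functions on $\mathbb R$ that are constant on $I_{j,k}$. For a bounded density $f$ and $x\in(0,1]$, $K_{j,x}(f)(z)=2^j\int_{I_{j,k(x)}}f(y)\,dy$ if $z\in I_{j,k(x)}$ and $K_{j,x}(f)(z)=f(z)$ otherwise. Linear (dyadic histogram) estimator: $f_n(j,x)=\frac1n\sum_{i=1}^n2^j1_{I_{j,k(x)}}(X_i)$ for $x\in(0,1]$. Set $1/s_n(j,x)=1/\sqrt{f_n(j,x)}$ if $f_n(j,x)>0$ and $1/s_n(j,x)=0$ otherwise. Maximal level: $j_{\max}=j_{\max,n}\in\mathbb N$ is fixed with $2^{-j_{\max}}\ge d(\log n)^2/n$ for some $d>0$. Adaptive estimator: for thresholds $\zeta_n$, $J\in\mathbb N$ with $J\le j_{\max}$ and $x\in(0,1]$, let $$\hat j_n(J,x)=\min\Bigl\{j\in\mathbb N,\ J\le j\le j_{\max}:\ \sqrt{n2^{-j'}}\,|f_n(j',x)-f_n(j,x)|\le\zeta_n\sqrt{f_n(j,x)}\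 \text{ for all } j'\text{ with } j<j'\le j_{\max}\Bigr\}$$ (and $\hat j_n(J,x)=j_{\max}$ if the condition is not met for any such $j$), $\hat f_n(J,x)=f_n(\hat j_n(J,x),x)$, and $\hat f_n(x)=\hat f_n(0,x)$. Uniform propagation condition: the thresholds $\zeta_n$ satisfy $\mathrm{UP}(\alpha,\mathcal F_{j,k})$ if for every $n$, every $j\le j_{\max}$, every $m=0,\dots,2^{j_{\max}}-1$, and every $f\in\mathcal F_{j,k(m)}$, where $k(m)$ is the unique $k$ with $I_{j_{\max},m}\subseteq I_{j,k}$, $$E_f\left(\sup_{x\in I_{j_{\max},m}}\max_{j\le j'\le j_{\max}}\sqrt{\frac{n2^{-j'}}{\log n}}\left|\frac{\hat f_n(j',x)-f_n(j',x)}{s_n(j',x)}\right|\right)^2\le\frac{\alpha}{n2^{2j_{\max}}}.$$ *)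

(* Defs.v *)
From HB Require Import structures.
From mathcomp Require Import all_boot all_order all_algebra.
From mathcomp Require Import all_classical all_reals all_analysis.
From mathcomp Require Import measurable_realfun.

Set Implicit Arguments.
Unset Strict Implicit.
Unset Printing Implicit Defensive.

Import Order.TTheory GRing.Theory Num.Theory.
Import numFieldNormedType.Exports.

Local Open Scope classical_set_scope.
Local Open Scope ring_scope.

Record density (R : realType) := Density {
  density_fun :> R -> R;
  measurable_density : measurable_fun [set: R] density_fun;
  density_ge0 : forall x, 0 <= density_fun x;
  integral_density : (\int[lebesgue_measure]_x (density_fun x)%:E = 1)%E }.

Definition density_prob (R : realType) (f : density R) : set R -> \bar R :=
  fun A => (\int[lebesgue_measure]_(x in A) (f x)%:E)%E.

Lemma density_prob0 (R : realType) (f : density R) :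
  density_prob f set0 = 0%E.
Proof. by rewrite /density_prob integral_set0. Qed.

Lemma density_prob_ge0 (R : realType) (f : density R) (A : set R) :
  (0 <= density_prob f A)%E.
Proof. by apply: integral_ge0 => x _; rewrite lee_fin density_ge0. Qed.

Lemma density_prob_sigma_additive (R : realType) (f : density R) :
  semi_sigma_additive (density_prob f).
Proof.
move=> F mF tF mUF; rewrite /density_prob ge0_integral_bigcup//=; last 2 first.
- apply/measurable_EFinP; apply: measurable_funS (measurable_density f) => //.
- by move=> x _; rewrite lee_fin density_ge0.
apply: is_cvg_ereal_nneg_natsum_cond => n _ _.
by apply: integral_ge0 => x _; rewrite lee_fin density_ge0.
Qed.

HB.instance Definition _ (R : realType) (f : density R) :=
  isMeasure.Build _ _ _ (density_prob f) (density_prob0 f)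
    (density_prob_ge0 f) (@density_prob_sigma_additive R f).

HB.instance Definition _ (R : realType) (f : density R) :=
  Measure_isProbability.Build _ _ _ (density_prob f) (integral_density f).

Definition tuple_cons (R : realType) (n : nat) (p : R * n.-tuple R) :
  n.+1.-tuple R := [tuple of p.1 :: p.2].

Lemma measurable_tuple_cons (R : realType) (n : nat) :
  measurable_fun [set: R * n.-tuple R] (@tuple_cons R n).
Proof. exact: measurable_cons. Qed.

HB.instance Definition _ (R : realType) (n : nat) :=
  isMeasurableFun.Build _ _ _ _ (@tuple_cons R n)
    (@measurable_tuple_cons R n).

Definition prod_prob (R : realType) (n : nat) (P : probability R R)
  (Q : probability (n.-tuple R) R) : set (R * n.-tuple R) -> \bar R :=
  (P \x Q)%E.

HB.instance Definition _ (R : realType) (n : nat) (P : probability R R)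
  (Q : probability (n.-tuple R) R) := Measure.on (prod_prob P Q).

Lemma prod_prob_setT (R : realType) (n : nat) (P : probability R R)
  (Q : probability (n.-tuple R) R) : prod_prob P Q [set: R * n.-tuple R] = 1%E.
Proof.
rewrite /prod_prob -setXTT product_measure1E//.
rewrite -[RHS]mule1; congr (_ * _)%E; exact: probability_setT.
Qed.

HB.instance Definition _ (R : realType) (n : nat) (P : probability R R)
  (Q : probability (n.-tuple R) R) :=
  Measure_isProbability.Build _ _ _ (prod_prob P Q) (prod_prob_setT P Q).

(* The n-fold product of P on R^n, i.e. the joint law of (X_1, ..., X_n) i.i.d.
   with law P; see [iid_lawE] for its value on boxes. *)
Fixpoint iid_law (R : realType) (P : probability R R) (n : nat) :
    probability (n.-tuple R) R :=
  match n with
  | 0 => dirac [tuple]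
  | m.+1 => distribution (prod_prob P (iid_law P m)) (@tuple_cons R m)
  end.

Lemma iid_lawE (R : realType) (P : probability R R) (n : nat)
    (A : 'I_n -> set R) : (forall i, measurable (A i)) ->
  iid_law P n [set w | forall i, A i (tnth w i)] = (\prod_(i < n) P (A i))%E.
Proof.
elim: n A => [|n IHn] A mA.
  by rewrite big_ord0 /= diracE mem_set// => -[].
rewrite big_ord_recl -IHn //= /distribution /pushforward.
rewrite -product_measure1E //; last first.
  have -> : [set w : n.-tuple R | forall i, A (lift ord0 i) (tnth w i)] =
      \bigcap_(i in [set: 'I_n]) ((@tnth n R)^~ i @^-1` A (lift ord0 i)).
    by apply/seteqP; split=> w /= Aw i => [_|]; apply: Aw.
  apply: fin_bigcap_measurable => // i _.
  by rewrite -[X in measurable X]setTI; exact: measurable_tnth.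
congr (product_measure1 _ _ _); apply/seteqP; split=> -[x w] /=.
- move=> Aw; split; first by have := Aw ord0.
  by move=> i; have := Aw (lift ord0 i); rewrite tnthS.
- move=> [Ax Aw] i; case: (unliftP ord0 i) => [j ->|-> //].
  by rewrite tnthS.
Qed.

Definition sup_norm (R : realType) (g : R -> R) : \bar R :=
  ereal_sup [set `|g x|%:E | x in [set: R]].

Definition dyadic (R : realType) (j k : nat) : set R :=
  `]k%:R * 2 ^- j, k.+1%:R * 2 ^- j].
Arguments dyadic R j k : clear implicits.

(* Meaningful for x in ]0, 1] only, where exactly one such k exists. *)
Definition dyadic_index (R : realType) (j : nat) (x : R) : nat :=
  xget 0%N [set k : nat | (k < 2 ^ j)%N /\ dyadic R j k x].

Definition dyadic_at (R : realType) (j : nat) (x : R) : set R :=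
  dyadic R j (dyadic_index j x).

Definition V_class (R : realType) (j k : nat) : set (density R) :=
  [set f | (sup_norm f < +oo)%E /\
           {in dyadic R j k &, forall y z, f y = f z}].
Arguments V_class R j k : clear implicits.

Definition F_class (R : realType) (delta M : R) (j k : nat) :
    set (density R) :=
  V_class R j k `&`
  [set f | [/\ 0 < delta,
    (delta%:E <= ereal_inf [set (f x)%:E | x in `]0%R, 1%R] ])%E
    & (sup_norm f <= M%:E)%E]].

Definition local_proj (R : realType) (j : nat) (x : R) (f : R -> R) : R -> R :=
  fun z => if z \in dyadic_at j x
           then 2 ^+ j * (\int[lebesgue_measure]_(y in dyadic_at j x) f y)
           else f z.

Definition hist (R : realType) (n : nat) (w : n.-tuple R) (j : nat) (x : R) :
    R :=
  n%:R^-1 * \sum_(i < n) 2 ^+ j * \1_(dyadic_at j x) (tnth w i).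

Definition inv_s (R : realType) (n : nat) (w : n.-tuple R) (j : nat) (x : R) :
    R :=
  if 0 < hist w j x then (Num.sqrt (hist w j x))^-1 else 0.

Definition accepted (R : realType) (n jmax : nat) (zeta : R)
    (w : n.-tuple R) (x : R) (j : nat) : bool :=
  [forall j' : 'I_jmax.+1, (j < j')%N ==>
    (Num.sqrt (n%:R * 2 ^- j') * `|hist w j' x - hist w j x|
      <= zeta * Num.sqrt (hist w j x))].

(* The head of the increasing list of admissible levels is their minimum. *)
Definition jhat (R : realType) (n jmax : nat) (zeta : R) (w : n.-tuple R)
    (J : nat) (x : R) : nat :=
  head jmax [seq j <- index_iota J jmax.+1 | accepted jmax zeta w x j].

Definition fhat (R : realType) (n jmax : nat) (zeta : R) (w : n.-tuple R)
    (J : nat) (x : R) : R :=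
  hist w (jhat jmax zeta w J x) x.

(* sup_{x in I_{jmax,m}} max_{j <= j' <= jmax} of the normalized stochastic
   differences; the terms are nonnegative, so 0 is a neutral default for the
   maximum. *)
Definition prop_error (R : realType) (n jmax : nat) (zeta : R)
    (w : n.-tuple R) (j m : nat) : \bar R :=
  ereal_sup [set (\big[Num.max/0%R]_(j <= j' < jmax.+1)
      (Num.sqrt (n%:R * 2 ^- j' / ln n%:R) *
       `|(fhat jmax zeta w j' x - hist w j' x) * inv_s w j' x|))%:E
    | x in dyadic R jmax m].

(* E_f is the integral against the product law; the square is inside the
   expectation. The k with I_{jmax,m} `<=` I_{j,k} is unique. *)
Definition uniform_propagation (R : realType) (jmax : nat -> nat)
    (zeta : nat -> R) (alpha : R) (F : nat -> nat -> set (density R)) : Prop :=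
  forall n j m k : nat, (1 < n)%N -> (j <= jmax n)%N ->
    (m < 2 ^ jmax n)%N -> (k < 2 ^ j)%N ->
    dyadic R (jmax n) m `<=` dyadic R j k ->
  forall f : density R, F j k f ->
    (\int[iid_law (density_prob f) n]_w
        (prop_error (jmax n) (zeta n) w j m ^+ 2)
      <= (alpha / (n%:R * 2 ^+ (2 * jmax n)))%:E)%E.

Definition Delta_bias (R : realType) (M delta : R) (f : R -> R) (j : nat)
    (x : R) : \bar R :=
  ((M / delta ^+ 2 * 2 ^- j)%:E *
   sup_norm (fun z => f z - local_proj j x f z)%R ^+ 2)%E.

(* None encodes the minimum of the empty set, i.e. +oo. *)
Definition jstar (R : realType) (n jmax : nat) (M delta Delta : R) (f : R -> R)
    (x : R) : option nat :=
  ohead [seq j <- index_iota 0 jmax.+1 |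
    (n%:R%:E * Delta_bias M delta f j x <= (Delta * ln n%:R)%:E)%E].

(* sqrt (n 2^-j / log n), with 2^-oo = 0. *)
Definition rate (R : realType) (n : nat) (oj : option nat) : R :=
  if oj is Some j then Num.sqrt (n%:R * 2 ^- j / ln n%:R) else 0.

Definition sup_error (R : realType) (n jmax : nat) (zeta M delta Delta : R)
    (f : R -> R) (w : n.-tuple R) : \bar R :=
  ereal_sup [set (rate R n (jstar n jmax M delta Delta f x) *
      `|fhat jmax zeta w 0 x - f x|)%:E | x in `]0%R, 1%R] ].

Definition bounded_in_prob (R : realType)
    (P : forall n : nat, probability (n.-tuple R) R)
    (Y : forall n : nat, n.-tuple R -> \bar R) : Prop :=
  forall eps : R, 0 < eps -> exists C : R, \forall n \near \oo,
    (P n [set w | C%:E < `|Y n w|] <= eps%:E)%E.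

(* Main.v *)
Require Import Defs.
From HB Require Import structures.
From mathcomp Require Import all_boot all_order all_algebra.
From mathcomp Require Import all_classical all_reals all_analysis.
From mathcomp Require Import measurable_realfun.
From mathcomp Require Import ring lra.

Set Implicit Arguments.
Unset Strict Implicit.
Unset Printing Implicit Defensive.

Import Order.TTheory GRing.Theory Num.Theory.
Import numFieldNormedType.Exports.

Local Open Scope classical_set_scope.
Local Open Scope ring_scope.

(* The estimator, the level jstar and the propagation error only depend on the
   data through the dyadic cells of level jmax containing the X_i, so the i.i.d.
   law can be replaced by a product law on a finite set.

   On a cell with level j = jstar, let g be f0 averaged over I_{j,k}: the second
   moment under g of the n-fold likelihood ratio of f0 to g is at most
   exp(n Delta_j) <= n^Delta.  This transfers the propagation bound from g to
   f0, and a union bound over the 2^jmax cells leaves a probability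
   O(n^(Delta - 1/2)), which is where Delta < 1/2 is needed.
   A Chernoff bound controls the linear estimator at level jstar on all cells.

   On the resulting event, either jhat(0) >= jstar and
   fhat(0) = fhat(jstar) is close to the linear estimator by propagation, or
   jhat(0) < jstar was accepted, and the acceptance inequality at level jstar
   gives the same. *)

(** * Product laws on finitely many cells *)

Lemma measure_fibers (d : measure_display) (X : measurableType d)
    (R : realType) (mu : {measure set X -> \bar R}) (T : finType) (h : X -> T)
    (D : set X) :
  (forall t, measurable (h @^-1` [set t])) -> measurable D ->
  mu D = (\sum_t mu (D `&` h @^-1` [set t]))%E.
Proof.
move=> mh mD.
have {1}-> : D = \bigcup_(t in [set: T]) (D `&` h @^-1` [set t]).
  apply/seteqP; split=> [x Dx|x [t _ []]//].
  by exists (h x).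
rewrite measure_fin_bigcup//.
- rewrite (fsbigE (enum T)) ?enum_uniq//.
  + rewrite big_enum_cond /=; apply: eq_bigl => t.
    by rewrite in_setT.
  + by move=> t _; rewrite mem_enum.
- exact: finite_finset.
- by move=> s t _ _ [x [[_ <-] [_ <-]]].
- by move=> t _; exact: measurableI.
Qed.

Section saturated.
Variables (R : realType) (T : finType) (h : R -> T).
Hypothesis mh : forall t, measurable (h @^-1` [set t]).
Variables (n : nat) (A : set (n.-tuple R)).
Hypothesis satA : forall w w' : n.-tuple R,
  (forall i, h (tnth w i) = h (tnth w' i)) -> A w -> A w'.

Let box (c : {ffun 'I_n -> T}) : set (n.-tuple R) :=
  [set w | forall i, (h @^-1` [set c i]) (tnth w i)].

Let measurable_box c : measurable (box c).
Proof.
have -> : box c =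
    \bigcap_(i in [set: 'I_n]) ((@tnth n R)^~ i @^-1` (h @^-1` [set c i])).
  by apply/seteqP; split=> w /= bw i => [_|]; apply: bw.
apply: fin_bigcap_measurable => // i _.
by rewrite -[X in measurable X]setTI; exact: measurable_tnth.
Qed.

(** [A] is the union of the boxes it meets, and there are finitely many boxes. Events defined by
    suprema over uncountably many [x] become measurable in this way. *)
Lemma measurable_saturated : measurable A.
Proof.
have -> : A = \bigcup_(c in [set c | A `&` box c !=set0]) box c.
  apply/seteqP; split=> [w Aw|w [c [w' [Aw' bw']]] bw].
    have bw : box [ffun i => h (tnth w i)] w by move=> i; rewrite ffunE.
    by exists [ffun i => h (tnth w i)] => //; exists w.
  by apply: satA Aw' => i; rewrite bw' bw.
by apply: fin_bigcup_measurable => //; exact: finite_finset.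
Qed.

(** A box that meets [A] lies inside it, and the law of a box is a product by [iid_lawE]. *)
Lemma iid_law_saturated (P : probability R R) :
  iid_law P n A = (\sum_(c : {ffun 'I_n -> T} | `[< A `&` box c !=set0 >])
    \prod_i P (h @^-1` [set c i]))%E.
Proof.
pose hh (w : n.-tuple R) := [ffun i => h (tnth w i)].
have hhE c : hh @^-1` [set c] = box c.
  apply/seteqP; split=> [w /= <- i|w bw /=]; first by rewrite /= ffunE.
  by apply/ffunP => i; rewrite ffunE; apply: bw.
rewrite (@measure_fibers _ _ _ _ _ hh) => [|c|]; last 2 first.
- by rewrite hhE.
- exact: measurable_saturated.
rewrite [RHS]big_mkcond; apply: eq_bigr => c _; rewrite hhE.
case: asboolP => [[w' [Aw' bw']]|nA].
  rewrite -iid_lawE//; congr (iid_law P n _).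
  apply/seteqP; split=> [w []//|w bw]; split=> //.
  by apply: satA Aw' => i; rewrite bw' bw.
rewrite (_ : _ `&` _ = set0) ?measure0//.
by apply/eqP; apply: contrapT => /negP/set0P.
Qed.

End saturated.

(** The index set does not depend on [P], so two laws can be compared term by term. *)
Lemma iid_law_saturatedE (R : realType) (T : finType) (h : R -> T)
    (mh : forall t, measurable (h @^-1` [set t])) (n : nat)
    (A : set (n.-tuple R))
    (satA : forall w w' : n.-tuple R,
      (forall i, h (tnth w i) = h (tnth w' i)) -> A w -> A w')
    (P : probability R R) :
  iid_law P n A = (\sum_(c : {ffun 'I_n -> T} |
      `[< exists2 w, A w & forall i, h (tnth w i) = c i >])
    \prod_i fine (P (h @^-1` [set c i])))%:E.
Proof.
rewrite (iid_law_saturated mh satA) -sumEFin; apply: eq_big => [c|c _].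
  by apply: asbool_equiv_eq; split=> [[w [Aw bw]]|[w Aw bw]]; exists w.
rewrite -prodEFin; apply: eq_bigr => i _.
by rewrite fineK// fin_num_measure.
Qed.

Lemma sum_fibers1 (R : realType) (T : finType) (h : R -> T)
    (mh : forall t, measurable (h @^-1` [set t])) (P : probability R R) :
  \sum_t fine (P (h @^-1` [set t])) = 1.
Proof.
apply: EFin_inj; rewrite -sumEFin -(probability_setT P).
rewrite [RHS](measure_fibers _ mh)//; apply: eq_bigr => t _.
by rewrite setTI fineK// fin_num_measure.
Qed.

(* From [(1 - x)(1 + x + 2x^2) = 1 + x^2 (1 - 2x) >= 1] and [1 - x <= exp(-x)]. *)
Lemma expR_le_quadratic (R : realType) (x : R) :
  x <= 2^-1 -> expR x <= 1 + x + 2 * x ^+ 2.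
Proof.
move=> x2.
have : (1 - x) * (1 + x + 2 * x ^+ 2) >= 1.
  have -> : (1 - x) * (1 + x + 2 * x ^+ 2) = 1 + x ^+ 2 * (1 - 2 * x) by ring.
  by rewrite lerDl mulr_ge0 ?sqr_ge0//; lra.
have := expR_ge1Dx (- x); rewrite expRN => h1 h2.
have ex := expR_gt0 x.
have : (1 - x) * expR x <= 1.
  by rewrite -[leRHS](mulVf (lt0r_neq0 ex)) ler_pM2r.
have x1 : 0 < 1 - x by lra.
move=> h3; rewrite -(ler_pM2l x1); exact: le_trans h2.
Qed.

(** * Chernoff bound for the number of observations in a set *)

Section chernoff.
Variables (R : realType) (P : probability R R) (B : set R).
Hypothesis mB : measurable B.
Let h (y : R) : bool := y \in B.
Let p := fine (P B).
Let pr (b : bool) := fine (P (h @^-1` [set b])).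

Let h_true : h @^-1` [set true] = B.
Proof. by apply/seteqP; split=> y; [exact: set_mem|exact: mem_set]. Qed.

Let h_false : h @^-1` [set false] = ~` B.
Proof.
apply/seteqP; split=> y; rewrite /= /h.
  by move=> /negbT /negP nB By; apply/nB/mem_set.
by move=> nB; apply/negbTE/negP => /set_mem.
Qed.

Let mh b : measurable (h @^-1` [set b]).
Proof. by case: b; rewrite ?h_true ?h_false//; exact: measurableC. Qed.

Let p_ge0 : 0 <= p. Proof. exact: fine_ge0. Qed.
Let pr_ge0 b : 0 <= pr b. Proof. exact: fine_ge0. Qed.

(** Centred Bernoulli moment generating function: after factoring out [exp(- s p)], what remains is
    [1 + p (exp(s) - 1) <= exp(p (exp(s) - 1))], and [expR_le_quadratic] bounds the exponent. *)
Let mgf (s : R) : `|s| <= 2^-1 ->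
  \sum_b pr b * expR (s * (b%:R - p)) <= expR (2 * p * s ^+ 2).
Proof.
move=> s2; have s2' : s <= 2^-1 by apply: le_trans s2; exact: ler_norm.
have := sum_fibers1 mh P; rewrite !big_bool/= -/(pr _) -/(pr _).
have -> : pr true = p by rewrite /pr h_true.
move=> /(canRL (addKr _)) ->.
have -> : s * (1 - p) = s + - (s * p) by ring.
have -> : s * (0 - p) = - (s * p) by ring.
rewrite expRD.
have -> : p * (expR s * expR (- (s * p))) + (- p + 1) * expR (- (s * p)) =
   expR (- (s * p)) * (1 + p * (expR s - 1)) by ring.
have -> : 2 * p * s ^+ 2 = - (s * p) + (p * (s + 2 * s ^+ 2)) by ring.
rewrite expRD ler_pM2l ?expR_gt0//.
apply: le_trans (expR_ge1Dx _); rewrite lerD2l ler_wpM2l//.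
by have := expR_le_quadratic s2'; lra.
Qed.

Let mgf_sum (n : nat) (s : R) : `|s| <= 2^-1 ->
  \sum_(c : {ffun 'I_n -> bool})
    (\prod_i pr (c i)) * expR (s * (\sum_i (c i)%:R - n%:R * p)) <=
  expR (2 * n%:R * p * s ^+ 2).
Proof.
move=> s2.
rewrite (eq_bigr (fun c : {ffun _} =>
  \prod_(i < n) (pr (c i) * expR (s * ((c i)%:R - p))))); last first.
  move=> c _; rewrite big_split /= -expR_sum -mulr_sumr sumrB.
  by rewrite sumr_const card_ord mulr_natl.
rewrite -(bigA_distr_bigA (fun _ b => pr b * expR (s * (b%:R - p)))) /=.
rewrite prodr_const card_ord.
have -> : 2 * n%:R * p * s ^+ 2 = n%:R * (2 * p * s ^+ 2) by ring.
rewrite expRM_natl; apply: lerXn2r; rewrite ?nnegrE ?expR_ge0//; last exact: mgf.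
by apply: sumr_ge0 => b _; rewrite mulr_ge0 ?expR_ge0.
Qed.

(** Both tails are treated at once: with [S] the centred count, the indicator of [|S| > v] is at
    most [exp(- l v) (exp(l S) + exp(- l S))]. The parameter [l] is left free for a later choice. *)
Lemma iid_law_count_deviation (n : nat) (l v : R) : 0 <= l <= 2^-1 ->
  (iid_law P n [set w | (v < `|\sum_(i < n) \1_B (tnth w i) - n%:R * p|)%R] <=
   (2 * expR (2 * n%:R * p * l ^+ 2 - l * v))%:E)%E.
Proof.
move=> /andP[l0 l2].
rewrite (iid_law_saturatedE mh) => [|w w' ww']; last first.
  rewrite /= (eq_bigr (fun i => \1_B (tnth w' i)))// => i _.
  by rewrite !indicE; congr (_%:R); rewrite -/(h _) ww'.
rewrite lee_fin.
pose S (c : {ffun 'I_n -> bool}) : R := \sum_i (c i)%:R - n%:R * p.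
apply: (@le_trans _ _ (\sum_(c : {ffun 'I_n -> bool})
    expR (- (l * v)) * ((\prod_i pr (c i)) * expR (l * S c) +
                        (\prod_i pr (c i)) * expR (- l * S c)))); last first.
  rewrite -mulr_sumr big_split /=.
  have nl : `|l| <= 2^-1 by rewrite ger0_norm.
  have := mgf_sum n nl; have := @mgf_sum n (- l); rewrite normrN sqrrN.
  move=> /(_ nl) h1 h2.
  rewrite expRD mulrA (mulrC _ (expR (- _))) ler_pM2l ?expR_gt0//.
  by rewrite mulr_natl mulr2n lerD.
rewrite big_mkcond; apply: ler_sum => c _.
have pc : 0 <= \prod_i pr (c i) by apply: prodr_ge0.
case: asboolP => [[w Aw wc]|_]; last first.
  by rewrite mulr_ge0 ?expR_ge0// addr_ge0 ?mulr_ge0 ?expR_ge0.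
rewrite -mulrDr mulrCA -[leLHS]mulr1; apply: ler_wpM2l => //.
rewrite mulrDr -!expRD.
have vS : v < `|S c|.
  rewrite /S (eq_bigr (fun i => \1_B (tnth w i))) => [//|i _].
  by rewrite indicE -/(h _) wc.
have := vS; case: (ger0P (S c)) => S0 vS'.
  apply: ler_wpDr; rewrite ?expR_ge0// -[leLHS]expR0 ler_expR.
  by rewrite addrC subr_ge0; apply: ler_wpM2l => //; exact: ltW.
apply: ler_wpDl; rewrite ?expR_ge0// -[leLHS]expR0 ler_expR.
by rewrite mulNr -mulrN addrC subr_ge0; apply: ler_wpM2l => //; exact: ltW.
Qed.

End chernoff.

(** * Change of measure through the second moment of the likelihood ratio *)

Section change_of_measure.
Variables (R : realType) (T : finType) (h : R -> T).
Hypothesis mh : forall t, measurable (h @^-1` [set t]).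
Variables (P Q : probability R R).
Let p t := fine (P (h @^-1` [set t])).
Let q t := fine (Q (h @^-1` [set t])).

(* AM-GM: [2 p <= s p^2 / q + q / s] on each fiber of the product. *)
Lemma iid_law_change_of_measure (n : nat) (A : set (n.-tuple R)) (s chi : R) :
  (forall w w' : n.-tuple R,
    (forall i, h (tnth w i) = h (tnth w' i)) -> A w -> A w') ->
  0 < s -> (forall t, q t = 0 -> p t = 0) ->
  \sum_t p t ^+ 2 / q t <= 1 + chi ->
  (iid_law P n A <=
    (s / 2 * (1 + chi) ^+ n)%:E + (s^-1 / 2)%:E * iid_law Q n A)%E.
Proof.
move=> satA s0 qp0 chiP.
have p0 t : 0 <= p t by exact: fine_ge0.
have q0 t : 0 <= q t by exact: fine_ge0.
have pq0 t : 0 <= p t ^+ 2 / q t by rewrite divr_ge0// sqr_ge0.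
rewrite !(iid_law_saturatedE mh satA) -EFinM -EFinD lee_fin.
pose a (c : {ffun 'I_n -> T}) :=
  `[< exists2 w, A w & forall i, h (tnth w i) = c i >].
apply: (@le_trans _ _ (\sum_(c | a c) (s / 2 * \prod_i (p (c i) ^+ 2 / q (c i))
    + s^-1 / 2 * \prod_i q (c i)))).
  apply: ler_sum => c _; set pp := \prod_i _.
  rewrite prodf_div -/(p _) prodrXl.
  rewrite -[\prod_i p (c i)]/pp.
  set qq := \prod_(i < n) q (c i).
  have pp0 : 0 <= pp by apply: prodr_ge0 => i _; exact: p0.
  have qq0 : 0 <= qq by apply: prodr_ge0 => i _; exact: q0.
  (* Division by 0 yields 0, so the degenerate case must give [pp = 0]: a factor of [qq] vanishes,
     and then so does the matching factor of [pp]. *)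
  have [qqE|qqN] := eqVneq qq 0.
    have -> : pp = 0.
      move/eqP: qqE; rewrite prodf_seq_eq0 => /hasP[i _ /= /eqP qi].
      by rewrite /pp (bigD1 i)//= -/(p _) qp0// mul0r.
    by rewrite qqE invr0 !mulr0 addr0.
  have qq1 : 0 < qq by rewrite lt_def qqN.
  rewrite -subr_ge0.
  have -> : s / 2 * (pp ^+ 2 / qq) + s^-1 / 2 * qq - pp =
     (s * pp - qq) ^+ 2 / (2 * s * qq) by field; rewrite qqN gt_eqF.
  by rewrite divr_ge0 ?sqr_ge0// !mulr_ge0// ltW.
rewrite big_split /= -!mulr_sumr lerD// ler_wpM2l//; first by rewrite divr_ge0// ltW.
(* Once the restriction to [A] is dropped, the sum of products factors into the [n]-th power of a
   single sum. *)
apply: (@le_trans _ _ (\sum_(c : {ffun 'I_n -> T}) \prod_i (p (c i) ^+ 2 / q (c i)))).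
  rewrite [leLHS]big_mkcond; apply: ler_sum => c _.
  by case: ifP => // _; apply: prodr_ge0.
rewrite -(bigA_distr_bigA (fun _ t => p t ^+ 2 / q t)) /= prodr_const card_ord.
by apply: lerXn2r => //; rewrite nnegrE; [|apply: le_trans chiP]; apply: sumr_ge0.
Qed.

End change_of_measure.

(** * Comparison of densities *)

Section density_comparison.
Variable R : realType.
Local Notation mu := (@lebesgue_measure R).
Implicit Types (f g : density R) (A D : set R) (B : R).

Lemma measurable_density_EFin f A :
  measurable A -> measurable_fun A (fun x => (f x)%:E).
Proof.
move=> mA; apply/measurable_EFinP.
exact: measurable_funS (measurable_density f).
Qed.

Lemma density_prob_le f g A D B : measurable A -> measurable D -> 0 <= B ->
  (forall x, f x <= g x + B * \1_D x) ->
  (density_prob f A <= density_prob g A + B%:E * mu (A `&` D))%E.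
Proof.
move=> mA mD B0 fg.
have mi : measurable_fun A (fun x => (\1_D x : R)%:E).
  by apply/measurable_EFinP; exact: measurable_indic.
have -> : (B%:E * mu (A `&` D) = \int[mu]_(x in A) (B%:E * (\1_D x)%:E))%E.
  by rewrite ge0_integralZl//= integral_indic// setIC.
rewrite /density_prob -ge0_integralD//=.
- apply: ge0_le_integral => //=.
  + by move=> x _; rewrite lee_fin density_ge0.
  + exact: measurable_density_EFin.
  + apply: emeasurable_funD; first exact: measurable_density_EFin.
    exact: measurable_funeM.
  + by move=> x _; rewrite -EFinM -EFinD lee_fin.
- by move=> x _; rewrite lee_fin density_ge0.
- exact: measurable_density_EFin.
- by move=> x _; rewrite mule_ge0// lee_fin.
- exact: measurable_funeM.
Qed.

Lemma cst_le_density_prob f A B : measurable A -> 0 <= B ->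
  (forall x, A x -> B <= f x) -> (B%:E * mu A <= density_prob f A)%E.
Proof.
move=> mA B0 fB; rewrite -integral_cst//; apply: ge0_le_integral => //=.
- exact: measurable_density_EFin.
Qed.

Lemma density_prob_le_cst f A B : measurable A -> 0 <= B ->
  (forall x, A x -> f x <= B) -> (density_prob f A <= B%:E * mu A)%E.
Proof.
move=> mA B0 fB; rewrite -integral_cst//; apply: ge0_le_integral => //=.
- by move=> x _; rewrite lee_fin density_ge0.
- exact: measurable_density_EFin.
Qed.

(** With [m t] the Lebesgue measure of the part of the fiber in [D], integration gives
    [|p t - q t| <= B * m t] and [delta * m t <= q t]. Then [p^2 / q = 2 p - q + (p - q)^2 / q],
    where the last term is at most [B^2 / delta * m t]; summing over [t] uses that [p] and [q] have
    total mass 1 and [m] has total mass [l]. *)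
Lemma fiber_chi_square f g D B delta l (T : finType) (h : R -> T) :
  (forall t, measurable (h @^-1` [set t])) ->
  measurable D -> mu D = l%:E -> 0 <= B -> 0 < delta ->
  (forall x, ~ D x -> f x = g x) ->
  (forall x, D x -> `|f x - g x| <= B) ->
  (forall x, D x -> delta <= g x) ->
  let p t := fine (density_prob f (h @^-1` [set t])) in
  let q t := fine (density_prob g (h @^-1` [set t])) in
  (forall t, q t = 0 -> p t = 0) /\
  \sum_t p t ^+ 2 / q t <= 1 + B ^+ 2 / delta * l.
Proof.
move=> mh mD lD B0 d0 fg fgB gd p q.
pose m t := fine (mu (h @^-1` [set t] `&` D)).
have mE t : mu (h @^-1` [set t] `&` D) = (m t)%:E.
  rewrite fineK// ge0_fin_numE//; apply: (@le_lt_trans _ _ (mu D)).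
    by apply: measureIr; [exact: mh|exact: mD].
  by rewrite lD ltry.
have pE t : density_prob f (h @^-1` [set t]) = (p t)%:E.
  by rewrite fineK// fin_num_measure.
have qE t : density_prob g (h @^-1` [set t]) = (q t)%:E.
  by rewrite fineK// fin_num_measure.
have m0 t : 0 <= m t by apply: fine_ge0.
have pq t : p t <= q t + B * m t.
  rewrite -lee_fin EFinD EFinM -pE -qE -mE; apply: density_prob_le => // x.
  rewrite indicE; have [/set_mem Dx|/negP Dx] := boolP (x \in D).
    by rewrite mulr1; have := fgB _ Dx; rewrite ler_norml; lra.
  by rewrite mulr0 addr0 fg// => /mem_set.
have qp t : q t <= p t + B * m t.
  rewrite -lee_fin EFinD EFinM -pE -qE -mE; apply: density_prob_le => // x.
  rewrite indicE; have [/set_mem Dx|/negP Dx] := boolP (x \in D).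
    by rewrite mulr1; have := fgB _ Dx; rewrite ler_norml; lra.
  by rewrite mulr0 addr0 fg// => /mem_set.
have qm t : delta * m t <= q t.
  rewrite -lee_fin EFinM -qE -mE.
  apply: (@le_trans _ _ (density_prob g (h @^-1` [set t] `&` D))).
    apply: cst_le_density_prob => //; [exact: measurableI|exact: ltW|].
    by move=> x [_]; exact: gd.
  by apply: measureIl; [exact: mh|exact: mD].
have q0 t : 0 <= q t by apply: le_trans (qm t); rewrite mulr_ge0// ltW.
have p0 t : 0 <= p t by apply: fine_ge0.
have qp0 t : q t = 0 -> p t = 0.
  move=> qt; have mt : m t = 0.
    apply/eqP; rewrite eq_le m0 andbT; have := qm t; rewrite qt.
    by rewrite pmulr_rle0.
  by apply/eqP; rewrite eq_le p0 andbT; have := pq t; rewrite qt mt; lra.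
split => //.
apply: (@le_trans _ _ (\sum_t (2 * p t - q t + B ^+ 2 / delta * m t))).
  apply: ler_sum => t _; have [qt|qN] := eqVneq (q t) 0.
    rewrite qt qp0// invr0 !mulr0 subr0 add0r.
    by rewrite mulr_ge0// divr_ge0 ?sqr_ge0// ltW.
  have qt : 0 < q t by rewrite lt_def qN q0.
  have -> : p t ^+ 2 / q t = 2 * p t - q t + (p t - q t) ^+ 2 / q t by field.
  rewrite lerD2l ler_pdivrMr//.
  apply: (@le_trans _ _ (B ^+ 2 * m t ^+ 2)).
    rewrite -exprMn -[leLHS]real_normK ?num_real// lerXn2r ?nnegrE ?mulr_ge0//.
    by rewrite ler_norml; have := pq t; have := qp t; lra.
  have -> : B ^+ 2 / delta * m t * q t = B ^+ 2 * (m t * (q t / delta)) by ring.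
  rewrite ler_wpM2l ?sqr_ge0// expr2 ler_wpM2l// ler_pdivlMr//.
  by rewrite mulrC.
have sp : \sum_t p t = 1 by rewrite /p sum_fibers1.
have sq : \sum_t q t = 1 by rewrite /q sum_fibers1.
have sm : \sum_t m t = l.
  apply: EFin_inj; rewrite -sumEFin -lD.
  have -> : mu D = (\sum_t mu (D `&` h @^-1` [set t]))%E.
    by apply: (@measure_fibers _ _ _ mu); [exact: mh|exact: mD].
  by apply: eq_bigr => t _; rewrite -mE setIC.
rewrite big_split/= sumrB -!mulr_sumr sp sq sm; lra.
Qed.

End density_comparison.

(** * Averaging a density over a set *)

Section flatten.
Variables (R : realType) (f : density R) (D : set R) (a : R).
Local Notation mu := (@lebesgue_measure R).
Hypotheses (mD : measurable D) (a0 : 0 < a) (muD : mu D = (a^-1)%:E).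

(** For [D = dyadic_at j x] and [a = 2 ^+ j] this is [local_proj j x f] by conversion; only
    [mu D = 1 / a] matters for the properties below. *)
Definition flatten_fun (z : R) : R :=
  if z \in D then a * (\int[mu]_(y in D) f y) else f z.

Let mean := a * (\int[mu]_(y in D) f y).

Let meanE : density_prob f D = (mean * a^-1)%:E.
Proof.
rewrite /mean mulrC mulKf ?gt_eqF// /Rintegral -/(density_prob f D).
by rewrite fineK// fin_num_measure.
Qed.

Lemma le_flatten_mean (lo : R) : 0 <= lo -> (forall x, D x -> lo <= f x) ->
  lo <= mean.
Proof.
move=> lo0 fb; rewrite -(@ler_pM2r _ a^-1) ?invr_gt0// -lee_fin -meanE EFinM.
by rewrite -muD; exact: cst_le_density_prob.
Qed.

Lemma flatten_mean_ge0 : 0 <= mean.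
Proof. by apply: le_flatten_mean => // x _; exact: density_ge0. Qed.

Lemma flatten_mean_le (hi : R) : 0 <= hi -> (forall x, D x -> f x <= hi) ->
  mean <= hi.
Proof.
move=> hi0 fb; rewrite -(@ler_pM2r _ a^-1) ?invr_gt0// -lee_fin -meanE EFinM.
by rewrite -muD; exact: density_prob_le_cst.
Qed.

Lemma flatten_fun_ge0 z : 0 <= flatten_fun z.
Proof.
rewrite /flatten_fun; case: ifP => _; [exact: flatten_mean_ge0|exact: density_ge0].
Qed.

Lemma measurable_flatten_fun : measurable_fun [set: R] flatten_fun.
Proof.
apply: measurable_fun_ifT => //; last exact: measurable_density.
by apply: (measurable_fun_bool true); rewrite setTI preimage_mem_true.
Qed.

(** Splitting along [D], the mean keeps the mass of [D] and nothing changes outside. *)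
Lemma integral_flatten_fun : (\int[mu]_x (flatten_fun x)%:E = 1)%E.
Proof.
have mf A : measurable A -> measurable_fun A (fun x => (flatten_fun x)%:E).
  move=> mA; apply/measurable_EFinP.
  exact: measurable_funS measurable_flatten_fun.
rewrite -(integral_density f) -!(setvU D).
have mDC : measurable (~` D) by exact: measurableC.
have disD : [disjoint ~` D & D] by rewrite disj_set_sym; exact/disj_setPCl.
rewrite !ge0_integral_setU//=.
- congr (_ + _)%E.
    apply: eq_integral => x /set_mem Dx; rewrite /flatten_fun ifF//.
    by apply/negP => /set_mem.
  rewrite (eq_integral (cst mean%:E)) => [|x Dx]; last by rewrite /flatten_fun Dx.
  by rewrite integral_cst//= muD -EFinM -meanE.
- by rewrite setvU; exact: measurable_density_EFin.
- by move=> x _; rewrite lee_fin density_ge0.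
- by rewrite setvU; exact: mf.
- by move=> x _; rewrite lee_fin flatten_fun_ge0.
Qed.

Definition flatten_density : density R :=
  Density measurable_flatten_fun flatten_fun_ge0 integral_flatten_fun.

End flatten.

(** * Dyadic cells *)

Section dyadic_cells.
Variable R : realType.
Implicit Types (x y : R) (j k m J : nat).

Lemma dyadicE j k y : dyadic R j k y = (k%:R < y * 2 ^+ j <= k.+1%:R) :> Prop.
Proof.
by rewrite /dyadic/= in_itv/= ltr_pdivrMr ?exprn_gt0// ler_pdivlMr ?exprn_gt0.
Qed.

Lemma dyadic_inj j k k' y : dyadic R j k y -> dyadic R j k' y -> k = k'.
Proof.
rewrite !dyadicE => /andP[k1 k2] /andP[k3 k4].
have := lt_le_trans k1 k4; have := lt_le_trans k3 k2; rewrite !ltr_nat !ltnS.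
by move=> h1 h2; apply/eqP; rewrite eqn_leq h1 h2.
Qed.

Lemma dyadic_ex j y : 0 < y <= 1 -> exists2 k, (k < 2 ^ j)%N & dyadic R j k y.
Proof.
move=> /andP[y0 y1].
have e2 : 0 < (2 : R) ^+ j by exact: exprn_gt0.
have yj : y * 2 ^+ j <= (2 ^ j).-1.+1%:R.
  by rewrite prednK ?expn_gt0// natrX ler_piMl// ltW.
(* The index is the least [k] with [y * 2 ^+ j <= k + 1]; minimality gives the strict lower bound,
   and the witness [2 ^ j - 1] bounds it. *)
have exk : exists k, y * 2 ^+ j <= k.+1%:R by exists (2 ^ j).-1.
case: (ex_minnP exk) => k yk kmin; exists k.
  by rewrite -[X in (_ < X)%N]prednK ?expn_gt0// ltnS; exact: kmin.
rewrite dyadicE yk andbT; case: k yk kmin => [_ _|k yk kmin].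
  by rewrite mulr_gt0.
by rewrite ltNge; apply/negP => /kmin; rewrite ltnn.
Qed.

Lemma dyadic_sub01 j k y : (k < 2 ^ j)%N -> dyadic R j k y -> 0 < y <= 1.
Proof.
rewrite dyadicE => kj /andP[ky yk]; have e2 : 0 < (2 : R) ^+ j by exact: exprn_gt0.
rewrite -(@pmulr_lgt0 _ (2 ^+ j))// (le_lt_trans _ ky)//=.
rewrite -(ler_pM2r e2) mul1r (le_trans yk)//.
by rewrite -natrX ler_nat.
Qed.

(** Each interval of level [j] is cut into [2 ^ (J - j)] intervals of level [J], so the ancestor is
    found by integer division. *)
Lemma dyadic_coarsen j J m y : (j <= J)%N -> dyadic R J m y ->
  dyadic R j (m %/ 2 ^ (J - j)) y.
Proof.
move=> jJ; rewrite !dyadicE => /andP[my ym].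
set q := (2 ^ (J - j))%N; have q0 : (0 < q)%N by rewrite expn_gt0.
have qR : 0 < (q%:R : R) by rewrite ltr0n.
have EJ : y * 2 ^+ J = y * 2 ^+ j * q%:R.
  by rewrite /q natrX -mulrA -exprD subnKC.
rewrite EJ in my ym; apply/andP; split.
  rewrite -(ltr_pM2r qR); apply: le_lt_trans my.
  by rewrite -natrM ler_nat leq_trunc_div.
by rewrite -(ler_pM2r qR) (le_trans ym)// -natrM ler_nat ltn_ceil.
Qed.

Lemma dyadic_coarsen_lt j J m : (j <= J)%N -> (m < 2 ^ J)%N ->
  (m %/ 2 ^ (J - j) < 2 ^ j)%N.
Proof. by move=> jJ mJ; rewrite ltn_divLR ?expn_gt0// -expnD subnKC. Qed.

Lemma measurable_dyadic j k : measurable (dyadic R j k).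
Proof. exact: measurable_itv. Qed.

Lemma lebesgue_measure_dyadic j k :
  lebesgue_measure (dyadic R j k) = (((2 : R) ^+ j)^-1)%:E.
Proof.
rewrite /dyadic lebesgue_measure_itv/= lte_fin ltr_pM2r ?invr_gt0 ?exprn_gt0//.
by rewrite ltr_nat ltnSn -EFinB -mulrBl -natrB// subSnn mul1r.
Qed.

Lemma dyadic_index_lt j x : (dyadic_index j x < 2 ^ j)%N.
Proof.
rewrite /dyadic_index; case: xgetP => [k _ []//|_].
by rewrite expn_gt0.
Qed.

Lemma dyadic_indexE j k x : (k < 2 ^ j)%N -> dyadic R j k x ->
  dyadic_index j x = k.
Proof.
move=> kj kx; rewrite /dyadic_index; case: xgetP => [k' _ [_ k'x]|/(_ k)[]//].
exact: dyadic_inj k'x kx.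
Qed.

Lemma dyadic_at_mem j x : 0 < x <= 1 -> dyadic_at j x x.
Proof.
move=> x01; have [k kj kx] := dyadic_ex j x01.
by rewrite /dyadic_at (dyadic_indexE kj kx).
Qed.

Lemma dyadic_index_cell j J m x : (j <= J)%N -> (m < 2 ^ J)%N ->
  dyadic R J m x -> dyadic_index j x = (m %/ 2 ^ (J - j))%N.
Proof.
move=> jJ mJ mx; apply: dyadic_indexE; first exact: dyadic_coarsen_lt.
exact: dyadic_coarsen.
Qed.

(** The value [None] collects the points outside []0, 1]], which makes this a total map to a finite
    type. *)
Definition cell J y : option 'I_(2 ^ J) :=
  [pick m : 'I_(2 ^ J) | y \in dyadic R J m].

Lemma cell_some J (m : 'I_(2 ^ J)) y : (cell J y = Some m) = dyadic R J m y :> Prop.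
Proof.
apply/propext; rewrite /cell; case: pickP => [m' /set_mem m'y|nm]; split => //.
- by move=> [<-].
- by move=> my; congr Some; apply: val_inj; exact: dyadic_inj m'y my.
- by move=> my; have := nm m; rewrite mem_set.
Qed.

Lemma measurable_cell J c : measurable (@cell J @^-1` [set c]).
Proof.
case: c => [m|].
  have -> : @cell J @^-1` [set Some m] = dyadic R J m.
    by apply/seteqP; split=> y; rewrite /= cell_some.
  exact: measurable_dyadic.
have -> : @cell J @^-1` [set None] =
    ~` \bigcup_(m in [set: 'I_(2 ^ J)]) dyadic R J m.
  apply/seteqP; split=> y /=.
    by move=> cy [m _]; rewrite -cell_some cy.
  move=> ny; case E: (cell J y) => [m|//]; exfalso; apply: ny; exists m => //.
  by rewrite -cell_some.
apply: measurableC; apply: fin_bigcup_measurable => [|m _].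
  exact: finite_finset.
exact: measurable_dyadic.
Qed.

(** A point of a coarse interval lies in []0, 1]], hence in some interval of level [J]; that
    interval is contained in the coarse one and also holds the other point. *)
Lemma mem_dyadic_cell j J k y y' : (j <= J)%N -> (k < 2 ^ j)%N ->
  cell J y = cell J y' -> (y \in dyadic R j k) = (y' \in dyadic R j k).
Proof.
move=> jJ kj; wlog suff : y y' / cell J y = cell J y' ->
    dyadic R j k y -> dyadic R j k y'.
  by move=> h yy'; apply/idP/idP => /set_mem yk; apply/mem_set; apply: h yk.
move=> yy' yk; have [m mJ my] := dyadic_ex J (dyadic_sub01 kj yk).
have -> : k = (m %/ 2 ^ (J - j))%N.
  exact: dyadic_inj yk (dyadic_coarsen jJ my).
apply: dyadic_coarsen => //.
by rewrite -[m]/(val (Ordinal mJ)) -cell_some -yy' cell_some.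
Qed.

End dyadic_cells.

(** * Dependence on the data and on the point through finest cells only *)

Section cell_invariance.
Variables (R : realType) (n J : nat) (w w' : n.-tuple R).
Hypothesis ww' : forall i, cell J (tnth w i) = cell J (tnth w' i).

Lemma hist_cell j x : (j <= J)%N -> hist w j x = hist w' j x.
Proof.
move=> jJ; rewrite /hist; congr (_ * _); apply: eq_bigr => i _.
rewrite !indicE; congr (_ * (_%:R)); congr nat_of_bool.
exact: mem_dyadic_cell (dyadic_index_lt _ _) (ww' i).
Qed.

Lemma jhat_cell zeta j x : jhat J zeta w j x = jhat J zeta w' j x.
Proof.
rewrite /jhat; congr head; apply: eq_in_filter => i.
rewrite mem_index_iota ltnS => /andP[_ iJ]; apply: eq_forallb => j'.
by rewrite !(hist_cell x)// -ltnS.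
Qed.

(** Neither the listed levels nor the default exceed [J], so [hist_cell] applies at the selected
    level. *)
Lemma jhat_le zeta j x : (jhat J zeta w j x <= J)%N.
Proof.
rewrite /jhat; case E: [seq _ <- _ | _] => [//|i s].
have : i \in [seq i <- index_iota j J.+1 | accepted J zeta w x i].
  by rewrite E mem_head.
by rewrite mem_filter mem_index_iota => /and3P[].
Qed.

Lemma fhat_cell zeta j x : fhat J zeta w j x = fhat J zeta w' j x.
Proof. by rewrite /fhat -jhat_cell; apply: hist_cell; exact: jhat_le. Qed.

Lemma prop_error_cell zeta j m : prop_error J zeta w j m = prop_error J zeta w' j m.
Proof.
rewrite /prop_error; congr ereal_sup; apply: eq_imagel => x _; congr EFin.
apply: eq_big_nat => i /andP[_ iJ].
by rewrite fhat_cell /inv_s (hist_cell x).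
Qed.

Lemma sup_error_cell zeta M delta Delta f :
  sup_error J zeta M delta Delta f w = sup_error J zeta M delta Delta f w'.
Proof.
rewrite /sup_error; apply: congr1; apply: eq_imagel => x _.
by rewrite fhat_cell.
Qed.

End cell_invariance.

(** The point enters only through [dyadic_at j x] with [j <= J], which is common to a whole cell of
    level [J]. One representative per finest cell therefore suffices. *)
Lemma jstar_cell (R : realType) n J (M delta Delta : R) f m x x' :
  (m < 2 ^ J)%N -> dyadic R J m x -> dyadic R J m x' ->
  jstar n J M delta Delta f x = jstar n J M delta Delta f x'.
Proof.
move=> mJ mx mx'.
rewrite /jstar.
apply: (congr1 (@ohead nat)).
apply: eq_in_filter => j.
rewrite mem_index_iota ltnS => /andP[_ jJ].
suff -> : Delta_bias M delta f j x = Delta_bias M delta f j x' by [].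
suff E : local_proj j x f = local_proj j x' f by rewrite /Delta_bias E.
have E : dyadic_at j x = dyadic_at j x'.
  by rewrite /dyadic_at (dyadic_index_cell jJ mJ mx) (dyadic_index_cell jJ mJ mx').
by rewrite /local_proj E.
Qed.

Lemma jstarP (R : realType) n J (M delta Delta : R) f x j :
  jstar n J M delta Delta f x = Some j ->
  (j <= J)%N /\
  (n%:R%:E * Delta_bias M delta f j x <= (Delta * ln n%:R)%:E)%E.
Proof.
have mem_ohead (s : seq nat) : ohead s = Some j -> j \in s.
  by case: s => //= i s [->]; rewrite mem_head.
by move=> /mem_ohead; rewrite mem_filter mem_index_iota ltnS => /and3P[].
Qed.

(** If no level below [j] is accepted, the searches from 0 and from [j] see the same list; otherwise
    the first accepted level is below [j]. *)
Lemma jhat_dichotomy (R : realType) n J (zeta : R) (w : n.-tuple R) j x :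
  (j <= J)%N -> jhat J zeta w 0 x = jhat J zeta w j x \/
  (jhat J zeta w 0 x < j)%N /\ accepted J zeta w x (jhat J zeta w 0 x).
Proof.
move=> jJ; rewrite /jhat.
have -> : index_iota 0 J.+1 = index_iota 0 j ++ index_iota j J.+1.
  by rewrite /index_iota !subn0 -iotaD subnKC// leqW.
rewrite filter_cat; case E: [seq _ <- index_iota 0 j | _] => [|i s]; first by left.
have : i \in [seq i <- index_iota 0 j | accepted J zeta w x i].
  by rewrite E mem_head.
by rewrite mem_filter mem_index_iota /= => /andP[ai ij]; right.
Qed.

(** * Error bounds on the good event and its probability *)

(** The unknown [a] on the right is absorbed: [a - h <= C sqrt(a) <= (C^2 + a) / 2] gives
    [a <= 2 h + C^2], and [sqrt(a) <= (1 + a) / 2] concludes. *)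
Lemma le_self_bounded (R : realType) (a h C r : R) : 0 <= C -> 1 <= r ->
  0 <= a -> 0 <= h -> r * `|h - a| <= C * Num.sqrt a ->
  r * `|h - a| <= C * (1 + 2 * h + C ^+ 2).
Proof.
move=> C0 r1 a0 h0 ra.
set s := Num.sqrt a in ra *; have s0 : 0 <= s by exact: sqrtr_ge0.
have aE : a = s ^+ 2 by rewrite sqr_sqrtr.
have hs : `|h - a| <= C * s.
  by apply: le_trans ra; rewrite ler_peMl.
have ab : a <= 2 * h + C ^+ 2.
  have : a - h <= C * s by apply: le_trans hs; rewrite distrC ler_norm.
  have : 0 <= (C - s) ^+ 2 by exact: sqr_ge0.
  rewrite sqrrB -aE; lra.
apply: (le_trans ra); rewrite ler_wpM2l//.
have : 0 <= (1 - s) ^+ 2 by exact: sqr_ge0.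
rewrite sqrrB -aE; lra.
Qed.

(** Triangle inequality through the linear estimate [h] at level [j] and its [mean]. The three
    errors are controlled by selection, by the deviation [t] and by the bias [b]. *)
Lemma adaptive_error_le (R : realType) (n J : nat) (zeta : R) (w : n.-tuple R)
    (j : nat) (x y mean r L C M delta t b : R) :
  (j <= J)%N -> 0 < L -> 0 <= C -> 0 < delta ->
  r = Num.sqrt (n%:R * 2 ^- j / L) -> 1 <= r -> 2 * t <= delta * r ->
  zeta <= C * Num.sqrt L ->
  r * `|(fhat J zeta w j x - hist w j x) * inv_s w j x| <= 1 ->
  delta <= mean <= M ->
  r * `|hist w j x - mean| <= t ->
  r * `|mean - y| <= b ->
  r * `|fhat J zeta w 0 x - y| <=
    (1 + M + t) + C * (1 + 2 * (M + t) + C ^+ 2) + t + b.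
Proof.
move=> jJ L0 C0 d0 rE r1 tr zC propj /andP[dm mM] histj biasj.
have r0 : 0 < r by exact: lt_le_trans r1.
set h := hist w j x in propj histj *.
have t0 : 0 <= t by apply: le_trans histj; rewrite mulr_ge0// ltW.
have hm : `|h - mean| <= t.
  by apply: le_trans histj; rewrite ler_peMl.
have hM : h <= M + t by have := ler_norm (h - mean); lra.
(* Since [2 * t <= delta * r], the deviation is at most [delta / 2]. Positivity of [h] excludes the
   default value 0 of [inv_s], for which the propagation bound would be empty. *)
have h0 : 0 < h.
  have : r * (2 * `|h - mean|) <= r * delta by lra.
  rewrite ler_pM2l// => hd; have := ler_norm (mean - h); rewrite distrC; lra.
have hist_ge0 i : 0 <= hist w i x.
  rewrite /hist mulr_ge0 ?invr_ge0//; apply: sumr_ge0 => k _.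
  by rewrite mulr_ge0 ?exprn_ge0// indicE.
suff main : r * `|fhat J zeta w 0 x - h| <=
    (1 + M + t) + C * (1 + 2 * (M + t) + C ^+ 2).
  apply: (@le_trans _ _ (r * (`|fhat J zeta w 0 x - h| + `|h - mean| + `|mean - y|))).
    rewrite ler_wpM2l ?(ltW r0)//.
    have -> : fhat J zeta w 0 x - y =
      fhat J zeta w 0 x - h + (h - mean) + (mean - y) by ring.
    by rewrite (le_trans (ler_normD _ _))// lerD2r ler_normD.
  by rewrite [leLHS]mulrDr lerD// [leLHS]mulrDr lerD.
have M0 : 0 <= M by lra.
have Ct0 : 0 <= C * (1 + 2 * (M + t) + C ^+ 2).
  by rewrite mulr_ge0// !addr_ge0// ?sqr_ge0// mulr_ge0// addr_ge0.
have [jE|[j0 acc]] := jhat_dichotomy (n := n) zeta w x jJ.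
(* Propagation gives the bound [sqrt(h)], at most [1 + h]. *)
- have -> : fhat J zeta w 0 x = fhat J zeta w j x by rewrite /fhat jE.
  move: propj; rewrite /inv_s -/h h0 normrM mulrA.
  have s0 : 0 < Num.sqrt h by rewrite sqrtr_gt0.
  rewrite (gtr0_norm (x := _^-1)) ?invr_gt0// ler_pdivrMr// mul1r => hj.
  apply: (le_trans hj).
  have : 0 <= (1 - Num.sqrt h) ^+ 2 by exact: sqr_ge0.
  rewrite sqrrB (sqr_sqrtr (ltW h0)); lra.
(* The accepted level is below [j], so its acceptance test includes the comparison with level
   [j]. *)
- move/forallP: acc => /(_ (Ordinal (jJ : (j < J.+1)%N))) /implyP/(_ j0) /=.
  rewrite -/(fhat J zeta w 0 x) -/h; set a := fhat J zeta w 0 x => acc.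
  have a0 : 0 <= a by exact: hist_ge0.
  have sL : 0 < Num.sqrt L by rewrite sqrtr_gt0.
  have rL : Num.sqrt (n%:R * 2 ^- j) = r * Num.sqrt L.
    rewrite rE -sqrtrM; last by rewrite !mulr_ge0// ?invr_ge0 ?exprn_ge0// ltW.
    by rewrite divfK// gt_eqF.
  rewrite distrC; apply: (@le_trans _ _ (C * (1 + 2 * h + C ^+ 2))); last first.
    apply: (@le_trans _ _ (C * (1 + 2 * (M + t) + C ^+ 2))).
      by rewrite ler_wpM2l//; lra.
    lra.
  apply: le_self_bounded => //; first exact: ltW.
  rewrite -(ler_pM2r sL).
  have -> : r * `|h - a| * Num.sqrt L = Num.sqrt (n%:R * 2 ^- j) * `|h - a|.
    by rewrite rL; ring.
  apply: (le_trans acc).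
  by rewrite mulrAC ler_wpM2r ?sqrtr_ge0.
Qed.

Lemma prop_error_term_le1 (R : realType) (n J : nat) (zeta : R) (w : n.-tuple R)
    (j m : nat) (x : R) : (j <= J)%N -> dyadic R J m x ->
  (prop_error J zeta w j m <= 1)%E ->
  Num.sqrt (n%:R * 2 ^- j / ln n%:R) *
    `|(fhat J zeta w j x - hist w j x) * inv_s w j x| <= 1.
Proof.
move=> jJ mx; rewrite -lee_fin; apply: le_trans.
apply: le_trans; last by apply: ereal_sup_ubound; exists x.
by rewrite lee_fin big_ltn// le_max lexx.
Qed.

Lemma measurable_saturated_fun (R : realType) (T : finType) (h : R -> T)
    (mh : forall t, measurable (h @^-1` [set t])) (n : nat)
    (F : n.-tuple R -> \bar R) :
  (forall w w' : n.-tuple R,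
    (forall i, h (tnth w i) = h (tnth w' i)) -> F w = F w') ->
  measurable_fun [set: n.-tuple R] F.
Proof.
move=> FE _ B mB; rewrite setTI; apply: (measurable_saturated mh) => w w' ww'.
by rewrite /= (FE _ _ ww').
Qed.

Lemma markov_square (d : measure_display) (X : measurableType d)
    (R : realType) (mu : {measure set X -> \bar R}) (F : X -> \bar R) :
  measurable_fun [set: X] F -> (forall w, 0 <= F w)%E ->
  (mu [set w | (1 < F w)%E] <= \int[mu]_w (F w ^+ 2))%E.
Proof.
move=> mF F0.
have mA : measurable [set w | (1 < F w)%E].
  by rewrite -[X in measurable X]setTI; exact: emeasurable_fun_o_infty.
set A := [set w | _] in mA *.
have -> : mu A = (\int[mu]_w (\1_A w)%:E)%E by rewrite integral_indic// setIT.
apply: ge0_le_integral => //.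
- by apply/measurable_EFinP; exact: measurable_indic.
- rewrite (_ : (fun _ => _) = (fun w => F w * F w)%E) => [|//].
  exact: emeasurable_funM.
- move=> w _; rewrite indicE; have [/set_mem/= w1|_] := boolP (_ \in _).
    by rewrite -[leLHS]mule1 lee_pmul// ltW.
  by rewrite expe2 mule_ge0.
Qed.

(** Chernoff with [l^2 = 2^j L / n] and [v = (2 M + 2) L / l]: the exponent is at most
    [2 M L - (2 M + 2) L = - 2 L]. The condition on [n] is exactly [l <= 1/2]. *)
Lemma hist_deviation (R : realType) (P : probability R R) (n j : nat)
    (x M L : R) : let p := fine (P (dyadic_at j x)) in
  0 < L -> 2 ^+ j * p <= M -> 4 * (2 ^+ j * L) <= n%:R ->
  (iid_law P n [set w | (2 * M + 2 <
      Num.sqrt (n%:R * 2 ^- j / L) * `|hist w j x - 2 ^+ j * p|)%R] <=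
    (2 * expR (- (2 * L)))%:E)%E.
Proof.
move=> p L0 pM nL.
have e2 : 0 < (2 : R) ^+ j by exact: exprn_gt0.
have n0 : 0 < (n%:R : R) by apply: lt_le_trans nL; rewrite !mulr_gt0.
set l := Num.sqrt (2 ^+ j * L / n%:R).
have l0 : 0 < l by rewrite sqrtr_gt0 divr_gt0 ?mulr_gt0.
have lE : l ^+ 2 = 2 ^+ j * L / n%:R.
  by rewrite sqr_sqrtr// ltW// divr_gt0 ?mulr_gt0.
have l2 : l <= 2^-1.
  have -> : 2^-1 = Num.sqrt ((2^-1 : R) ^+ 2) by rewrite sqrtr_sqr ger0_norm.
  rewrite ler_wsqrtr// ler_pdivrMr//.
  by rewrite expr2; lra.
have rE : Num.sqrt (n%:R * 2 ^- j / L) = l^-1.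
  rewrite -sqrtrV; last by rewrite ltW// divr_gt0 ?mulr_gt0.
  by congr Num.sqrt; field; rewrite ?gt_eqF.
rewrite rE (_ : [set w | _] = [set w : n.-tuple R | (2 * M + 2) * L / l <
    `|\sum_(i < n) \1_(dyadic_at j x) (tnth w i) - n%:R * p|]); last first.
  apply/seteqP; suff E (w : n.-tuple R) :
      l^-1 * `|hist w j x - 2 ^+ j * p| = l / L *
      `|\sum_(i < n) \1_(dyadic_at j x) (tnth w i) - n%:R * p|.
    have lL (a b : R) : (a < l / L * b) = (a * L / l < b).
      by rewrite mulrAC ltr_pdivlMr// ltr_pdivrMr// (mulrC b).
    by split=> w /=; rewrite E lL.
  have -> : hist w j x - 2 ^+ j * p = 2 ^+ j / n%:R *
      (\sum_(i < n) \1_(dyadic_at j x) (tnth w i) - n%:R * p).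
    by rewrite /hist -mulr_sumr; field; rewrite gt_eqF.
  rewrite normrM mulrA gtr0_norm ?divr_gt0//; congr (_ * _).
  have -> : 2 ^+ j / n%:R = l ^+ 2 / L by rewrite lE; field; rewrite !gt_eqF.
  by field; rewrite !gt_eqF.
have mD : measurable (dyadic_at j x) by exact: measurable_dyadic.
have := @iid_law_count_deviation R P (dyadic_at j x) mD n l ((2 * M + 2) * L / l).
rewrite (ltW l0) l2 => /(_ isT) h; apply: le_trans h _.
rewrite lee_fin ler_wpM2l// ler_expR -/p lE.
have -> : 2 * n%:R * p * (2 ^+ j * L / n%:R) - l * ((2 * M + 2) * L / l) =
  2 * (2 ^+ j * p) * L - (2 * M + 2) * L by field; rewrite !gt_eqF.
have : 2 ^+ j * p * L <= M * L by rewrite ler_pM2r.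
lra.
Qed.

Lemma sup_normP (R : realType) (g : R -> R) (B : R) :
  (sup_norm g <= B%:E)%E <-> forall x, `|g x| <= B.
Proof.
split=> [gB x|gB].
  by rewrite -lee_fin; apply: le_trans gB; apply: ereal_sup_ubound; exists x.
by apply: ge_ereal_sup => _ [x _ <-]; rewrite lee_fin.
Qed.

Lemma sup_norm_ge0 (R : realType) (g : R -> R) : (0 <= sup_norm g)%E.
Proof.
apply: (@le_trans _ _ `|g 0|%:E); first by rewrite lee_fin.
by apply: ereal_sup_ubound; exists 0.
Qed.

(** * Transfer of the propagation bound from the averaged density *)

Section bounded_density.
Variables (R : realType) (f : density R) (M delta : R).
Hypotheses (fM : (sup_norm f <= M%:E)%E) (d0 : 0 < delta).
Hypothesis fd : (delta%:E <= ereal_inf [set (f x)%:E | x in `]0%R, 1%R] ])%E.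

Let f_le x : f x <= M.
Proof. by apply: le_trans (ler_norm _) _; move/sup_normP : fM; apply. Qed.

Let le_f x : 0 < x <= 1 -> delta <= f x.
Proof.
move=> x01; rewrite -lee_fin; apply: (le_trans fd); apply: ereal_inf_lbound.
by exists x => //=; rewrite in_itv.
Qed.

Lemma lower_le_upper : delta <= M.
Proof. by apply: le_trans (f_le 1); apply: le_f; rewrite ltr01 lexx. Qed.

Let M0 : 0 < M. Proof. exact: lt_le_trans lower_le_upper. Qed.

Lemma local_proj_le j x z : local_proj j x f z <= M.
Proof.
rewrite -[local_proj j x f z]/(flatten_fun f (dyadic_at j x) (2 ^+ j) z).
rewrite /flatten_fun; case: ifP => // _.
by apply: flatten_mean_le => //; rewrite ?exprn_gt0 ?ltW//;
   [exact: measurable_dyadic|exact: lebesgue_measure_dyadic].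
Qed.

Lemma mean_bounds j x : delta <= 2 ^+ j * fine (density_prob f (dyadic_at j x)) <= M.
Proof.
have e2 : 0 < (2 : R) ^+ j by exact: exprn_gt0.
have mD := @measurable_dyadic R j (dyadic_index j x).
have lD := @lebesgue_measure_dyadic R j (dyadic_index j x).
apply/andP; split; last by apply: (flatten_mean_le mD e2 lD) => //; exact: ltW.
apply: (le_flatten_mean mD e2 lD); first exact: ltW.
by move=> y /(dyadic_sub01 (dyadic_index_lt j x)); exact: le_f.
Qed.

Let flat j (x : R) : density R :=
  flatten_density f (@measurable_dyadic R j (dyadic_index j x))
    (exprn_gt0 j (ltr0Sn R 1)) (@lebesgue_measure_dyadic R j (dyadic_index j x)).

(** Averaging over a cell preserves the bounds [delta] and [M], so the propagation condition covers
    the averaged density. *)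
Lemma F_class_flatten j x : F_class delta M j (dyadic_index j x) (flat j x).
Proof.
have flatM : (sup_norm (flat j x) <= M%:E)%E.
  apply/sup_normP => z; rewrite ger0_norm ?density_ge0//.
  exact: local_proj_le.
split; [split|split => //].
- exact: le_lt_trans flatM (ltry _).
- by move=> y z Dy Dz; rewrite /= /flatten_fun Dy Dz.
- apply: le_ereal_inf_tmp => _ [y /= y01 <-]; rewrite lee_fin.
  rewrite /flatten_fun; case: ifP => _; last by apply: le_f; rewrite in_itv in y01.
  by have /andP[] := mean_bounds j x.
Qed.

(** The sup norm of the bias is finite, being at most [2 M]; its real value serves as [B]. *)
Lemma local_proj_bias (n j : nat) (x Delta : R) : (0 < n)%N ->
  (n%:R%:E * Delta_bias M delta f j x <= (Delta * ln n%:R)%:E)%E ->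
  exists B, [/\ 0 <= B, forall z, `|f z - local_proj j x f z| <= B &
    n%:R * (M / delta ^+ 2 * 2 ^- j * B ^+ 2) <= Delta * ln n%:R].
Proof.
move=> n0; rewrite /Delta_bias; set s := sup_norm _.
have s0 : (0 <= s)%E by exact: sup_norm_ge0.
have sM : (s <= (M + M)%:E)%E.
  apply/sup_normP => z; apply: (le_trans (ler_normB _ _)).
  rewrite !ger0_norm ?density_ge0 ?(density_ge0 (flat j x))//.
  by rewrite lerD// local_proj_le.
have sE : s = (fine s)%:E.
  by rewrite fineK// ge0_fin_numE// (le_lt_trans sM)// ltry.
move=> h; exists (fine s); split; first exact: fine_ge0.
  by apply/sup_normP; rewrite -/s -sE.
by move: h; rewrite sE -EFin_expe -!EFinM lee_fin.
Qed.

(** Markov and the propagation condition bound the event under the averaged density [g];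
    [iid_law_change_of_measure] carries this to [f]. The factor [2 ^- J] in the result pays for a
    union over all finest cells. *)
Lemma prop_error_deviation (n J j m : nat) (x zeta alpha Delta : R) :
  (1 < n)%N -> (j <= J)%N -> (m < 2 ^ J)%N -> dyadic R J m x ->
  (n%:R%:E * Delta_bias M delta f j x <= (Delta * ln n%:R)%:E)%E ->
  (forall k, (k < 2 ^ j)%N -> dyadic R J m `<=` dyadic R j k ->
    forall g : density R, F_class delta M j k g ->
    (\int[iid_law (density_prob g) n]_w (prop_error J zeta w j m ^+ 2)
      <= (alpha / (n%:R * 2 ^+ (2 * J)))%:E)%E) ->
  (iid_law (density_prob f) n [set w | (1 < prop_error J zeta w j m)%E] <=
    (2 ^- J * (expR (- ((2^-1 - Delta) * ln n%:R)) +
       alpha * expR (- (2^-1 * ln n%:R))) / 2)%:E)%E.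
Proof.
move=> n1 jJ mJ mx bias UP.
have n0 : (0 < n)%N by exact: ltnW.
have nR : 0 < (n%:R : R) by rewrite ltr0n.
have [B [B0 fB nB]] := local_proj_bias n0 bias.
set A := [set w | _].
have mh := @measurable_cell R J.
have satF (w w' : n.-tuple R) : (forall i, cell J (tnth w i) = cell J (tnth w' i)) ->
  prop_error J zeta w j m = prop_error J zeta w' j m.
  by move=> ww'; exact: prop_error_cell.
have satA (w w' : n.-tuple R) : (forall i, cell J (tnth w i) = cell J (tnth w' i)) ->
  A w -> A w'.
  by move=> ww'; rewrite /A/= (satF _ _ ww').
pose k := dyadic_index j x.
pose g := flat j x.
have QA : (iid_law (density_prob g) n A <=
    (alpha / (n%:R * 2 ^+ (2 * J)))%:E)%E.
  apply: le_trans (UP k (dyadic_index_lt _ _) _ g (F_class_flatten j x)).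
    apply: markov_square; first exact: (measurable_saturated_fun mh).
    move=> w; apply: le_trans (ereal_sup_ubound _); last by exists x.
    by rewrite lee_fin big_ltn// le_max; apply/orP; left; rewrite mulr_ge0// sqrtr_ge0.
  by rewrite /k (dyadic_index_cell jJ mJ mx) => y; exact: dyadic_coarsen.
have mD := @measurable_dyadic R j k.
have [qp chi] : (forall t, fine (density_prob g (cell J @^-1` [set t])) = 0 ->
    fine (density_prob f (cell J @^-1` [set t])) = 0) /\
  \sum_t fine (density_prob f (cell J @^-1` [set t])) ^+ 2 /
    fine (density_prob g (cell J @^-1` [set t])) <=
    1 + B ^+ 2 / delta * (2 ^+ j)^-1.
  apply: (fiber_chi_square mh mD (@lebesgue_measure_dyadic R j k) B0 d0) => y Dy.
  - by rewrite /g/= /flatten_fun ifF//; apply/negP => /set_mem.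
  - exact: fB.
  - rewrite /g/= /flatten_fun (mem_set Dy).
    by have /andP[] := mean_bounds j x.
set L := ln n%:R in nB *.
have nE : n%:R = expR L by rewrite lnK// posrE.
(* That is [s = 2^-J n^(-1/2)]: it makes the first term of order [2^-J n^(Delta - 1/2)] and turns
   [alpha / (s n 2^(2J))] into [alpha 2^-J n^(-1/2)]. *)
pose s : R := 2 ^- J * expR (- (2^-1 * L)).
have e2J : 0 < (2 : R) ^+ J by exact: exprn_gt0.
have s0 : 0 < s by rewrite mulr_gt0 ?invr_gt0 ?expR_gt0.
apply: (le_trans (iid_law_change_of_measure mh satA s0 qp chi)).
apply: (@le_trans _ _ ((s / 2 * expR (Delta * L))%:E +
    (s^-1 / 2)%:E * (alpha / (n%:R * 2 ^+ (2 * J)))%:E)%E).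
  apply: leeD.
    rewrite lee_fin ler_wpM2l ?divr_ge0// ?(ltW s0)//.
    set c := B ^+ 2 / delta * _ in chi *.
    have c0 : 0 <= c.
      by rewrite /c mulr_ge0 ?divr_ge0 ?sqr_ge0 ?(ltW d0)// invr_ge0 exprn_ge0.
    apply: (@le_trans _ _ (expR c ^+ n)).
      by apply: lerXn2r; rewrite ?nnegrE ?addr_ge0 ?expR_ge0 ?expR_ge1Dx.
    rewrite -expRM_natl ler_expR; apply: le_trans nB.
    rewrite ler_pM2l// /c.
    (* The weight [M / delta^2] exceeds the chi-square weight [1 / delta] by the factor
       [M / delta >= 1]. *)
    have -> : M / delta ^+ 2 * 2 ^- j * B ^+ 2 =
      (B ^+ 2 / delta * 2 ^- j) * (M / delta) by field; rewrite !gt_eqF ?exprn_gt0.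
    by rewrite ler_peMr// ler_pdivlMr// mul1r lower_le_upper.
  by apply: lee_wpmul2l => //; rewrite lee_fin divr_ge0// invr_ge0 ltW.
rewrite -EFinM -EFinD lee_fin.
have -> : expR (- ((2^-1 - Delta) * L)) = expR (- (2^-1 * L)) * expR (Delta * L).
  by rewrite -expRD; congr expR; ring.
have EL : n%:R = (expR (- (2^-1 * L)))^-1 ^+ 2.
  by rewrite -expRN opprK -expRM_natl nE; congr expR; field.
rewrite EL /s exprM; set u := expR (- _).
have u0 : u != 0 by rewrite gt_eqF// expR_gt0.
rewrite [leRHS](_ : _ = 2 ^- J * u / 2 * expR (Delta * L) +
  (2 ^- J * u)^-1 / 2 * (alpha / (u^-1 ^+ 2 * 2 ^+ 2 ^+ J)))//.
rewrite -exprM mulnC exprM.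
by field; rewrite u0 gt_eqF.
Qed.

End bounded_density.

Lemma expRN_le_eps (R : realType) (c eta L : R) : 0 < c -> 0 < eta ->
  (eta * c)^-1 <= L -> expR (- (c * L)) <= eta.
Proof.
move=> c0 e0 cL; rewrite expRN -[leRHS]invrK lef_pV2 ?posrE ?invr_gt0 ?expR_gt0//.
apply: le_trans (expR_ge1Dx _); apply: ler_wpDl => //.
apply: (@le_trans _ _ (c * (eta * c)^-1)); last by rewrite ler_pM2l.
by rewrite invfM mulrCA divff ?mulr1// gt_eqF.
Qed.

Lemma near_le_ln (R : realType) (A : R) : \forall n \near \oo, A <= ln (n%:R : R).
Proof.
near=> n; have An : expR A <= n%:R by near: n; exact: nbhs_infty_ger.
by rewrite -ler_expR lnK// posrE (lt_le_trans (expR_gt0 A)).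
Unshelve. all: by end_near.
Qed.

(** The square of the left side is at most [Delta * delta^2 / M <= M], because [delta <= M]; then
    [M <= (M + 1)^2] gives a bound free of square roots. *)
Lemma scaled_bias_le (R : realType) (N e L B M delta Delta : R) :
  0 < N -> 0 < e -> 0 < L -> 0 < delta -> delta <= M -> 0 <= B ->
  Delta <= 2^-1 -> N * (M / delta ^+ 2 * e * B ^+ 2) <= Delta * L ->
  Num.sqrt (N * e / L) * B <= M + 1.
Proof.
move=> N0 e0 L0 d0 dM B0 D2 NB; have M0 : 0 < M by exact: lt_le_trans dM.
have M1 : 0 <= M + 1 by rewrite addr_ge0// ltW.
have r0 : 0 <= N * e / L by rewrite divr_ge0 ?mulr_ge0 ?ltW.
rewrite -[leRHS]ger0_norm// -sqrtr_sqr -[B]ger0_norm// -sqrtr_sqr -sqrtrM//.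
rewrite ler_wsqrtr//; apply: (@le_trans _ _ M); last first.
  have -> : (M + 1) ^+ 2 = M + (1 + M + M ^+ 2) by ring.
  by rewrite lerDl !addr_ge0 ?sqr_ge0 ?(ltW M0).
have -> : N * e / L * B ^+ 2 =
    N * (M / delta ^+ 2 * e * B ^+ 2) * (delta ^+ 2 / M / L).
  by field; rewrite !gt_eqF.
have c0 : 0 < delta ^+ 2 / M / L by rewrite !divr_gt0 ?exprn_gt0.
apply: (@le_trans _ _ (Delta * L * (delta ^+ 2 / M / L))).
  by rewrite ler_pM2r.
have -> : Delta * L * (delta ^+ 2 / M / L) = Delta * (delta ^+ 2 / M).
  by field; rewrite !gt_eqF.
apply: (@le_trans _ _ (1 * (delta ^+ 2 / M))).
  by rewrite ler_pM2r ?divr_gt0 ?exprn_gt0//; lra.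
by rewrite mul1r ler_pdivrMr// expr2 ler_pM// ltW.
Qed.

(** The bound of [adaptive_error_le] at [C = K], [t = 2 M + 2] and [b = M + 1]. *)
Definition tail_const (R : realType) (M K : R) : R :=
  (1 + M + (2 * M + 2)) + K * (1 + 2 * (M + (2 * M + 2)) + K ^+ 2) +
  (2 * M + 2) + (M + 1).

(** * Union bound over the finest cells *)

Section tail.
Variables (R : realType) (f : density R) (M delta alpha d Delta K zeta : R).
Variables (n J : nat).
Hypotheses (fM : (sup_norm f <= M%:E)%E) (d0 : 0 < delta).
Hypothesis fd : (delta%:E <= ereal_inf [set (f x)%:E | x in `]0%R, 1%R] ])%E.
Local Notation L := (ln (n%:R : R)).
Local Notation t := (2 * M + 2).
Hypotheses (n1 : (1 < n)%N) (K0 : 0 <= K) (zK : zeta <= K * Num.sqrt L).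
Hypothesis Delta1 : Delta < 2^-1.
Hypotheses (dJ : d * L ^+ 2 / n%:R <= 2 ^- J) (L1 : 1 <= L).
Hypotheses (dL4 : 4 <= d * L) (dLt : 1 + (2 * t / delta) ^+ 2 <= d * L).
Hypothesis UP : forall j m k : nat, (j <= J)%N -> (m < 2 ^ J)%N -> (k < 2 ^ j)%N ->
  dyadic R J m `<=` dyadic R j k ->
  forall g : density R, F_class delta M j k g ->
    (\int[iid_law (density_prob g) n]_w (prop_error J zeta w j m ^+ 2)
      <= (alpha / (n%:R * 2 ^+ (2 * J)))%:E)%E.

Let L0 : 0 < L. Proof. exact: lt_le_trans L1. Qed.
Let P := density_prob f.
Let mean j x := 2 ^+ j * fine (P (dyadic_at j x)).
Let r j := Num.sqrt (n%:R * 2 ^- j / L).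
Let js := jstar n J M delta Delta f.

Let delta_le : delta <= M. Proof. exact: lower_le_upper fM fd. Qed.
Let M0 : 0 < M. Proof. exact: lt_le_trans delta_le. Qed.
Let n0 : 0 < n%:R :> R. Proof. by rewrite ltr0n ltnW. Qed.

(** The squared logarithm in the constraint on [J] leaves one factor [L] after normalization, so the
    rate can be made as large as needed at every level. *)
Let level_bound j : (j <= J)%N -> d * L <= n%:R * 2 ^- j / L.
Proof.
move=> jJ; have jJ' : 2 ^- J <= 2 ^- j :> R.
  by rewrite lef_pV2 ?posrE ?exprn_gt0// ler_weXn2l// ler1n.
have := le_trans dJ jJ'.
by rewrite ler_pdivrMr// ler_pdivlMr// expr2 mulrA [_ * n%:R]mulrC.
Qed.

Let r_ge j : (j <= J)%N -> 1 <= r j /\ 2 * t <= delta * r j.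
Proof.
move=> /level_bound lj; have t0 : 0 <= 2 * t / delta.
  by rewrite divr_ge0 ?(ltW d0)//; have := ltW M0; lra.
split.
  by rewrite -[leLHS]sqrtr1 ler_wsqrtr//; apply: le_trans lj; apply: le_trans dL4; lra.
rewrite -ler_pdivrMl// mulrC -[leLHS]ger0_norm// -sqrtr_sqr ler_wsqrtr//.
by apply: le_trans lj; apply: le_trans dLt; rewrite lerDr.
Qed.

(** The right endpoint, which belongs to the half-open cell. *)
Let rep m : R := m.+1%:R / 2 ^+ J.

Let rep_dyadic m : dyadic R J m (rep m).
Proof. by rewrite dyadicE /rep divfK ?gt_eqF ?exprn_gt0// ltr_nat ltnSn lexx. Qed.

(** Only the level [jstar] of the cell is examined. A cell without such a level has an empty bad
    event, in agreement with its [rate] being 0. *)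
Let bad m : set (n.-tuple R) := [set w | exists2 j, js (rep m) = Some j &
  ((1 < prop_error J zeta w j m)%E \/ t < r j * `|hist w j (rep m) - mean j (rep m)|)].

Let sup_error_le w : (forall m, (m < 2 ^ J)%N -> ~ bad m w) ->
  (`|sup_error J zeta M delta Delta f w| <= (tail_const M K)%:E)%E.
Proof.
(* The supremum is nonnegative because the term at [x = 1] is. *)
move=> nbad; rewrite gee0_abs; last first.
  apply: le_trans (ereal_sup_ubound _); last first.
    by exists 1 => //=; rewrite in_itv/= ltr01 lexx.
  by rewrite lee_fin mulr_ge0// /rate; case: jstar => // j; rewrite sqrtr_ge0.
have C0 : 0 <= tail_const M K.
  rewrite /tail_const !addr_ge0// ?(ltW M0)//; try (by have := ltW M0; lra).
  by rewrite mulr_ge0// !addr_ge0 ?sqr_ge0//; have := ltW M0; lra.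
apply: ge_ereal_sup => _ [x /= x01 <-]; rewrite in_itv/= in x01; rewrite lee_fin.
have [m mJ mx] := dyadic_ex J x01.
have jsE := jstar_cell n M delta Delta f mJ mx (rep_dyadic m).
case js_m : (jstar n J M delta Delta f x) => [j|]; last by rewrite /= mul0r.
have [jJ bias] := jstarP js_m.
have atE : dyadic_at j (rep m) = dyadic_at j x.
  rewrite /dyadic_at (dyadic_index_cell jJ mJ (rep_dyadic m)).
  by rewrite (dyadic_index_cell jJ mJ mx).
have hE : hist w j (rep m) = hist w j x by rewrite /hist atE.
have meanE : mean j (rep m) = mean j x by rewrite /mean atE.
have nbm := nbad m mJ.
have propj : (prop_error J zeta w j m <= 1)%E.
  by rewrite leNgt; apply/negP => h; apply: nbm; exists j; [rewrite /js -jsE|left].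
have histj : r j * `|hist w j x - mean j x| <= t.
  rewrite -hE -meanE leNgt; apply/negP => h; apply: nbm.
  by exists j; [rewrite /js -jsE|right].
have [r1 rt] := r_ge jJ.
have meanb : delta <= mean j x <= M by exact: mean_bounds.
have propx : r j * `|(fhat J zeta w j x - hist w j x) * inv_s w j x| <= 1.
  exact: prop_error_term_le1 mx propj.
suff biasx : r j * `|mean j x - f x| <= M + 1.
  exact: (@adaptive_error_le R n J zeta w j x (f x) (mean j x) (r j) L K M delta
    t (M + 1) jJ L0 K0 d0 erefl r1 rt zK propx meanb histj biasx).
have [B [B0 fB nB]] := local_proj_bias fM d0 fd (ltnW n1) bias.
have projx : local_proj j x f x = mean j x.
  rewrite /local_proj (mem_set (dyadic_at_mem j x01)); reflexivity.
have fBx := fB x; rewrite projx distrC in fBx.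
have rj0 : 0 <= r j by exact: sqrtr_ge0.
apply: le_trans (ler_wpM2l rj0 fBx) _.
have e0 : 0 < (2 : R) ^- j by rewrite invr_gt0 exprn_gt0.
exact: scaled_bias_le n0 (e0) L0 d0 delta_le B0 (ltW Delta1) nB.
Qed.

Let mh := @measurable_cell R J.

Let bad_sat j m : (j <= J)%N ->
  measurable [set w : n.-tuple R | (1 < prop_error J zeta w j m)%E] /\
  measurable [set w : n.-tuple R | t < r j * `|hist w j (rep m) - mean j (rep m)|].
Proof.
move=> jJ; split; apply: (measurable_saturated mh) => w w' ww' /=.
  by rewrite (prop_error_cell ww').
by rewrite (hist_cell ww').
Qed.

Let pbad := 2 ^- J * (expR (- ((2^-1 - Delta) * L)) +
  alpha * expR (- (2^-1 * L))) / 2 + 2 * expR (- (2 * L)).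

Let bad_le m : 0 <= alpha -> (m < 2 ^ J)%N ->
  measurable (bad m) /\ (iid_law P n (bad m) <= pbad%:E)%E.
Proof.
move=> alpha0 mJ; case E : (js (rep m)) => [j|]; last first.
  have -> : bad m = set0 by apply/seteqP; split=> // w [j]; rewrite E.
  split; first exact: measurable0.
  rewrite measure0 lee_fin /pbad; apply: addr_ge0; last by rewrite mulr_ge0 ?expR_ge0.
  apply: divr_ge0 => //; apply: mulr_ge0; first by rewrite invr_ge0 exprn_ge0.
  by rewrite addr_ge0 ?mulr_ge0 ?expR_ge0.
have [jJ bias] := jstarP E; have [mA mB] := bad_sat m jJ.
have -> : bad m = [set w : n.-tuple R | (1 < prop_error J zeta w j m)%E] `|`
   [set w : n.-tuple R | t < r j * `|hist w j (rep m) - mean j (rep m)|].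
  apply/seteqP; split=> [w [j']|w]; first by rewrite E => -[<-].
  by move=> h; exists j.
split; first exact: measurableU.
apply: (le_trans (measureU2 _ mA mB)); rewrite EFinD; apply: leeD.
  apply: (prop_error_deviation fM d0 fd n1 jJ mJ (rep_dyadic m) bias).
  by move=> k kj sub; exact: UP.
apply: hist_deviation => //.
  by have /andP[] := mean_bounds fM d0 fd j (rep m).
(* The sample size condition [4 * 2^j * L <= n] follows from [4 <= d * L]. *)
have := le_trans dL4 (level_bound jJ); rewrite ler_pdivlMr//.
by rewrite ler_pdivlMr ?exprn_gt0// mulrAC mulrA.
Qed.

Lemma sup_error_tail : 0 <= alpha ->
  (iid_law P n [set w | ((tail_const M K)%:E <
     `|sup_error J zeta M delta Delta f w|)%E] <=
  ((expR (- ((2^-1 - Delta) * L)) + alpha * expR (- (2^-1 * L))) / 2 +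
   2 * expR (- L))%:E)%E.
Proof.
move=> alpha0.
pose F m := if (m < 2 ^ J)%N then bad m else set0.
have mF m : measurable (F m) by rewrite /F; case: ifP => // /(bad_le alpha0)[].
apply: (@le_trans _ _ (\sum_(m < 2 ^ J) iid_law P n (F m))%E).
  apply: content_subadditive => //.
    apply: (measurable_saturated mh) => w w' ww' /=.
    by rewrite (sup_error_cell ww').
  move=> w /=; rewrite ltNge => /negP h; apply: contrapT => nF; apply: h.
  apply: sup_error_le => m mJ bm; apply: nF.
  rewrite -bigcup_mkord; exists m => //=.
  by rewrite /F mJ.
apply: (@le_trans _ _ (\sum_(m < 2 ^ J) pbad%:E)%E).
  apply: lee_sum => m _; rewrite /F ltn_ord.
  by have [] := bad_le alpha0 (ltn_ord m).
rewrite sumEFin lee_fin sumr_const card_ord -[leLHS]mulr_natr natrX /pbad.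
have e2 : 0 < (2 : R) ^+ J by exact: exprn_gt0.
set E := expR _ + _.
have -> : (2 ^- J * E / 2 + 2 * expR (- (2 * L))) * 2 ^+ J =
   E / 2 + 2 * (2 ^+ J * expR (- (2 * L))).
  by field; rewrite gt_eqF.
rewrite lerD2l ler_pM2l//.
(* One factor [exp(- L) = 1 / n] absorbs the number of cells, since [2 ^ J <= n]; the other one
   remains. *)
have -> : 2 * L = L + L by ring.
rewrite opprD expRD mulrA -[leRHS]mul1r ler_pM2r ?expR_gt0//.
rewrite expRN lnK ?posrE// ler_pdivrMr// mul1r.
have dLn : d * L * L <= n%:R * 2 ^- J.
  by rewrite -ler_pdivlMr//; exact: level_bound.
rewrite -(mul1r (2 ^+ J)) -ler_pdivlMr//; apply: le_trans dLn.
rewrite -[leLHS]mulr1; apply: ler_pM => //; apply: le_trans dL4; lra.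
Qed.

End tail.

Theorem theorem2 (R : realType) (f0 : density R)
  (M delta alpha d Delta : R) (jmax : nat -> nat) (zeta : nat -> R)
  (f0_bounded : (sup_norm f0 <= M%:E)%E)
  (delta_gt0 : 0 < delta)
  (f0_lower : (delta%:E <= ereal_inf [set (f0 x)%:E | x in `]0%R, 1%R] ])%E)
  (d_gt0 : 0 < d)
  (jmaxP : forall n : nat, (1 < n)%N ->
    d * (ln n%:R) ^+ 2 / n%:R <= 2 ^- jmax n)
  (zetaO : (zeta : nat -> R^o) =O_\oo (fun n : nat => Num.sqrt (ln n%:R) : R^o))
  (alpha_gt0 : 0 < alpha)
  (UP : uniform_propagation jmax zeta alpha (F_class delta M))
  (Delta_gt0 : 0 < Delta) (Delta_lt : Delta < 2^-1) :
  bounded_in_prob (iid_law (density_prob f0))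
    (fun n => @sup_error R n (jmax n) (zeta n) M delta Delta f0).
Proof.
move=> eps eps0.
have [K K0 zK] : exists2 K : R, 0 < K & \forall n \near \oo,
    `|(zeta : nat -> R^o) n| <= K * `|(Num.sqrt (ln n%:R) : R^o)|.
  by apply/eqO_exP.
(* The constant does not depend on [eps]: the tail bound for it tends to 0. *)
exists (tail_const M K).
have e2 : 0 < eps / 2 by rewrite divr_gt0.
have ea : 0 < eps / (2 * alpha) by rewrite divr_gt0 ?mulr_gt0.
have e8 : 0 < eps / 8 by rewrite divr_gt0.
have D0 : 0 < 2^-1 - Delta by rewrite subr_gt0.
near=> n.
have n1 : (1 < n)%N by near: n; exact: nbhs_infty_gt.
have L1 : 1 <= ln (n%:R : R) by near: n; exact: near_le_ln.
have Ld A : A / d <= ln (n%:R : R) -> A <= d * ln (n%:R : R).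
  by rewrite ler_pdivrMr// mulrC.
have dL4 : 4 <= d * ln (n%:R : R).
  have L4 : 4 / d <= ln (n%:R : R) by near: n; exact: near_le_ln.
  exact: Ld.
have dLt : 1 + (2 * (2 * M + 2) / delta) ^+ 2 <= d * ln (n%:R : R).
  by apply: Ld; near: n; exact: near_le_ln.
have zn : zeta n <= K * Num.sqrt (ln (n%:R : R)).
  apply: (le_trans (ler_norm _)).
  rewrite -[Num.sqrt (ln (n%:R : R))]ger0_norm ?sqrtr_ge0//.
  by near: n.
(* Budget: [(eps/2 + eps/2) / 2] from propagation plus [2 * eps/8] from the linear estimator, at
   most [eps] in total. The exponent decays because [Delta < 1/2]. *)
have h1 : expR (- ((2^-1 - Delta) * ln (n%:R : R))) <= eps / 2.
  by apply: expRN_le_eps => //; near: n; exact: near_le_ln.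
have h2 : expR (- (2^-1 * ln (n%:R : R))) <= eps / (2 * alpha).
  by apply: expRN_le_eps => //; near: n; exact: near_le_ln.
have h3 : expR (- ln (n%:R : R)) <= eps / 8.
  rewrite -[ln _]mul1r; apply: expRN_le_eps => //; near: n; exact: near_le_ln.
apply: (le_trans (sup_error_tail f0_bounded delta_gt0 f0_lower n1 (ltW K0) zn
  Delta_lt (jmaxP n n1) L1 dL4 dLt _ (ltW alpha_gt0))).
  by move=> j m k jJ mJ kj sub g; exact: UP n1 jJ mJ kj sub g.
rewrite lee_fin .
have : alpha * expR (- (2^-1 * ln (n%:R : R))) <= eps / 2.
  have -> : eps / 2 = alpha * (eps / (2 * alpha)) by field; rewrite gt_eqF.
  by rewrite ler_pM2l.
lra.
Unshelve. all: by end_near.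
Qed.
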